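(* Let $(X;\sim,\backsim,\wedge,1)$ be a pseudo equality algebra and let $F$ be a normal deductive system of $X$. Let $\theta_F=\{(x,y)\in X\times X \mid x\sim y,\ y\sim x\in F\}$, for $x\in X$ let $x/F=\{y\in X\mid (x,y)\in\theta_F\}$, and let $X/F=\{x/F\mid x\in X\}$. Then $(X/F;\simeq,\backsimeq,\underline{\wedge},1/F)$ is a pseudo equality algebra, where $$x/F\simeq y/F:=(x\sim y)/F,\quad x/F\backsimeq y/F:=(x\backsim y)/F,\quad x/F\,\underline{\wedge}\, y/F:=(x\wedge y)/F .$$
   Context: A pseudo equality algebra is an algebra $(X;\sim,\backsim,\wedge,1)$ of type $(2,2,2,0)$ such that for all $a,b,c\in X$ (with $x\le y$ iff $x\wedge y=x$): (F1) $(X;\wedge,1)$ is a meet-semilattice with top element $1$; (F2) $a\sim a=1=a\backsim a$; (F3) $a\sim 1=a=1\backsim a$; (F4) $a\leq b\leq c$ implies $a\sim c\leq b\sim c$, $a\sim c\leq a\sim b$, $c\backsim a\leq c\backsim b$ and $c\backsim a\leq b\backsim a$; (F5) $a\sim b\leq (a\wedge c)\sim (b\wedge c)$ and $a\backsim b\leq (a\wedge c)\backsim (b\wedge c)$; (F6) $a\sim b\leq (c\sim a)\backsim (c\sim b)$ and $a\backsim b\leq (a\backsim c)\sim (b\backsim c)$; (F7) $a\sim b\leq (a\sim c)\sim (b\sim c)$ and $a\backsim b\leq (c\backsim a)\backsim (c\backsim b)$. A deductive system of $X$ is a subset $F\subseteq X$ with $1\in F$ such that $F$ is an upset ($a\in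 F$, $a\le b\in X$ imply $b\in F$) and $a,\,b\sim a\in F$ imply $b\in F$ for all $a,b\in X$. It is normal if for all $x,y\in X$: $x\sim y,\,y\sim x\in F$ if and only if $y\backsim x,\,x\backsim y\in F$. For normal $F$, the relation $\theta_F$ equals $\{(x,y)\mid x\backsim y,\,y\backsim x\in F\}$ and is a congruence relation on $X$ (an equivalence relation compatible with $\sim,\backsim,\wedge$), so the operations on $X/F$ are well defined. *)

(* Defs.v *)
From mathcomp Require Import all_boot.
From mathcomp Require Import boolp classical_sets.

Set Implicit Arguments.
Unset Strict Implicit.
Unset Printing Implicit Defensive.

Local Open Scope classical_set_scope.

Section PseudoEqualityAlgebra.
Context (X : Type) (sim bsim meet : X -> X -> X) (one : X).

Local Notation "a ∼ b" := (sim a b) (at level 45, no associativity).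
Local Notation "a ∽ b" := (bsim a b) (at level 45, no associativity).
Local Notation "a ∧ b" := (meet a b) (at level 40, left associativity).

Definition meet_le (x y : X) : Prop := x ∧ y = x.

Local Notation "x ≤ y" := (meet_le x y) (at level 70, no associativity).

Record is_top_meet_semilattice : Prop := IsTopMeetSemilattice {
  meet_assoc : forall a b c, a ∧ (b ∧ c) = (a ∧ b) ∧ c;
  meet_comm : forall a b, a ∧ b = b ∧ a;
  meet_idem : forall a, a ∧ a = a;
  le_one : forall a, a ≤ one
}.

Record is_pseudo_equality_algebra : Prop := IsPseudoEqualityAlgebra {
  pea_F1 : is_top_meet_semilattice;
  pea_F2 : forall a, a ∼ a = one /\ one = a ∽ a;
  pea_F3 : forall a, a ∼ one = a /\ a = one ∽ a;
  pea_F4 : forall a b c, a ≤ b -> b ≤ c ->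
    [/\ (a ∼ c) ≤ (b ∼ c), (a ∼ c) ≤ (a ∼ b),
        (c ∽ a) ≤ (c ∽ b) & (c ∽ a) ≤ (b ∽ a)];
  pea_F5 : forall a b c,
    (a ∼ b) ≤ ((a ∧ c) ∼ (b ∧ c)) /\ (a ∽ b) ≤ ((a ∧ c) ∽ (b ∧ c));
  pea_F6 : forall a b c,
    (a ∼ b) ≤ ((c ∼ a) ∽ (c ∼ b)) /\ (a ∽ b) ≤ ((a ∽ c) ∼ (b ∽ c));
  pea_F7 : forall a b c,
    (a ∼ b) ≤ ((a ∼ c) ∼ (b ∼ c)) /\ (a ∽ b) ≤ ((c ∽ a) ∽ (c ∽ b))
}.

Record is_deductive_system (F : set X) : Prop := IsDeductiveSystem {
  ds_one : F one;
  ds_upset : forall a b, F a -> a ≤ b -> F b;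
  ds_sim : forall a b, F a -> F (b ∼ a) -> F b
}.

Definition is_normal (F : set X) : Prop :=
  forall x y, (F (x ∼ y) /\ F (y ∼ x)) <-> (F (y ∽ x) /\ F (x ∽ y)).

End PseudoEqualityAlgebra.

Section Quotient.
Context (X : Type) (sim : X -> X -> X) (F : set X).

Definition theta (x y : X) : Prop := F (sim x y) /\ F (sim y x).

Definition theta_class (x : X) : set X := [set y | theta x y].

Definition quotient_set : set (set X) := range theta_class.

Definition quotient : Type := set_type quotient_set.

Definition to_quotient (x : X) : quotient :=
  SigSub (mem_set (imageT theta_class x)).

Lemma to_quotient_surj (A : quotient) : exists x, to_quotient x = A.
Proof.
case: A => A HA; have [x _ xA] := set_mem HA.
by exists x; apply: val_inj.
Qed.

Definition quotient_repr (A : quotient) : X := sval (cid (to_quotient_surj A)).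

(* The operation is computed on chosen representatives, so this definition does
   not presuppose that [op] is compatible with [theta]: independence of the
   choice is the equation
   [quotient_op op (to_quotient x) (to_quotient y) = to_quotient (op x y)]. *)
Definition quotient_op (op : X -> X -> X) (A B : quotient) : quotient :=
  to_quotient (op (quotient_repr A) (quotient_repr B)).

End Quotient.

(* Main.v *)
Require Import Defs.
From mathcomp Require Import all_boot.
From mathcomp Require Import boolp classical_sets.

(** The axioms of a pseudo equality algebra, apart from (F4), are identities or
    inequalities [s <= t], and an inequality is itself the identity
    [meet s t = s].  Identities pass to any quotient by a congruence, so the
    work is to show that [theta sim F] is a congruence and to deal with (F4).

    _Congruence._  The axioms (F5), (F6), (F7) bound [sim a b] from above by a
    comparison of [op a c] with [op b c], or of [op c a] with [op c b], and
    [bsim a b] likewise; since [F] is an upset, [theta a b] puts these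
    comparisons in [F].  For the right argument of [sim] and of [bsim] they are
    comparisons by [bsim] instead of [sim]; normality of [F] turns one kind into
    the other.  Normality also puts [bsim a b] and [bsim b a] in [F], from which
    the compatibility of [bsim] starts.  Transitivity of [theta] is (F7)
    followed by detachment in [F].

    _The implication_ (F4).  Its hypotheses [[a] <= [b] <= [c]] in the quotient
    do not give [a <= b <= c], but they say [[a] = [a /\ (b /\ c)]] and
    [[b] = [b /\ c]], and these new representatives do form a chain below [c]
    in [X], where (F4) applies. *)

(** * The congruence of a normal deductive system *)

Section Congruence.
Context {X : Type} {sim bsim meet : X -> X -> X} {one : X} {F : set X}.
Hypothesis hX : is_pseudo_equality_algebra sim bsim meet one.
Hypothesis hF : is_deductive_system sim meet one F.

Local Notation "x ≈ y" := (theta sim F x y) (at level 70, no associativity).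

Lemma theta_refl x : x ≈ x.
Proof. by rewrite /theta (pea_F2 hX x).1; split; exact: (ds_one hF). Qed.

Lemma theta_sym x y : x ≈ y -> y ≈ x.
Proof. by case. Qed.

(** By (F7), [sim x y <= sim (sim x z) (sim y z)], so [sim x z] is detached
    from [sim y z]. *)
Lemma ds_sim_trans {x y z} : F (sim x y) -> F (sim y z) -> F (sim x z).
Proof.
move=> Fxy Fyz; apply: (ds_sim hF Fyz).
exact: (ds_upset hF Fxy (pea_F7 hX x y z).1).
Qed.

Lemma theta_trans y {x z} : x ≈ y -> y ≈ z -> x ≈ z.
Proof.
by move=> [xy yx] [yz zy]; split; [exact: (ds_sim_trans xy yz) | exact: (ds_sim_trans zy yx)].
Qed.

(** An operation compatible with [theta] in each argument separately is
    compatible in both, through the intermediate element [op b c]. *)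
Lemma theta_op (op : X -> X -> X) :
    (forall c a b, a ≈ b -> op a c ≈ op b c) ->
    (forall c a b, a ≈ b -> op c a ≈ op c b) ->
  forall a b c d, a ≈ b -> c ≈ d -> op a c ≈ op b d.
Proof.
by move=> opl opr a b c d ab cd; apply: (theta_trans (op b c)); [apply: opl | apply: opr].
Qed.

Lemma theta_meet a b c d : a ≈ b -> c ≈ d -> meet a c ≈ meet b d.
Proof.
have meetl e x y : x ≈ y -> meet x e ≈ meet y e.
  by move=> [xy yx]; split;
    [apply: (ds_upset hF xy (pea_F5 hX _ _ _).1)
    |apply: (ds_upset hF yx (pea_F5 hX _ _ _).1)].
apply: theta_op => // e x y xy.
by rewrite !(meet_comm (pea_F1 hX) e); apply: meetl.
Qed.

Hypothesis hFn : is_normal sim bsim F.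

(** The right argument requires normality, because (F6) compares [sim c a] with
    [sim c b] by [bsim]. *)
Lemma theta_sim a b c d : a ≈ b -> c ≈ d -> sim a c ≈ sim b d.
Proof.
apply: theta_op => e x y [xy yx].
  by split; [apply: (ds_upset hF xy (pea_F7 hX _ _ _).1)
            |apply: (ds_upset hF yx (pea_F7 hX _ _ _).1)].
apply/hFn.
by split; [apply: (ds_upset hF yx (pea_F6 hX _ _ _).1)
          |apply: (ds_upset hF xy (pea_F6 hX _ _ _).1)].
Qed.

(** Mirror image of [theta_sim], after normality has rewritten [theta] by means
    of [bsim]. *)
Lemma theta_bsim a b c d : a ≈ b -> c ≈ d -> bsim a c ≈ bsim b d.
Proof.
apply: theta_op => e x y /hFn[yx xy].
  by split; [apply: (ds_upset hF xy (pea_F6 hX _ _ _).2)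
            |apply: (ds_upset hF yx (pea_F6 hX _ _ _).2)].
apply/hFn.
by split; [apply: (ds_upset hF yx (pea_F7 hX _ _ _).2)
          |apply: (ds_upset hF xy (pea_F7 hX _ _ _).2)].
Qed.

(** * Computing in the quotient *)

Local Notation cls := (to_quotient sim F).

Lemma to_quotient_eqP x y : cls x = cls y <-> x ≈ y.
Proof.
split=> [/(congr1 val) /= exy | xy].
  (* [y] lies in its own class, hence in that of [x]. *)
  have : theta_class sim F y y by apply: theta_refl.
  by rewrite -exy.
apply: val_inj => /=; apply/seteqP; split=> z; apply: theta_trans => //.
exact: theta_sym.
Qed.

Lemma quotient_op_class (op : X -> X -> X) :
    (forall a b c d, a ≈ b -> c ≈ d -> op a c ≈ op b d) ->
  forall x y, quotient_op op (cls x) (cls y) = cls (op x y).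
Proof.
move=> opP x y; apply/to_quotient_eqP.
by apply: opP; apply/to_quotient_eqP; rewrite /quotient_repr; case: cid.
Qed.

End Congruence.

(** * Transfer of the axioms along a surjective homomorphism *)

Section Image.
Context {X Y : Type} {sim bsim meet : X -> X -> X} {one : X}.
Context {simY bsimY meetY : Y -> Y -> Y} {f : X -> Y}.
Hypothesis hX : is_pseudo_equality_algebra sim bsim meet one.
Hypothesis f_surj : forall y, exists x, f x = y.
Hypothesis f_sim : forall a b, simY (f a) (f b) = f (sim a b).
Hypothesis f_bsim : forall a b, bsimY (f a) (f b) = f (bsim a b).
Hypothesis f_meet : forall a b, meetY (f a) (f b) = f (meet a b).

Lemma image_le a b : meet_le meet a b -> meet_le meetY (f a) (f b).
Proof. by rewrite /meet_le f_meet => ->. Qed.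

Lemma meet_le_right a b : meet_le meet (meet a b) b.
Proof.
by rewrite /meet_le -(meet_assoc (pea_F1 hX)) (meet_idem (pea_F1 hX)).
Qed.

(** The class is closed under homomorphic images although (F4) is an
    implication: a chain in the image lifts to a chain. *)
Lemma image_chain {a b c} :
    meet_le meetY (f a) (f b) -> meet_le meetY (f b) (f c) ->
  exists a' b', [/\ f a' = f a, f b' = f b, meet_le meet a' b' & meet_le meet b' c].
Proof.
rewrite /meet_le => ab bc.
have fbc : f (meet b c) = f b by rewrite -f_meet.
exists (meet a (meet b c)), (meet b c); split=> //; try exact: meet_le_right.
by rewrite -f_meet fbc.
Qed.

Lemma image_pseudo_equality_algebra :
  is_pseudo_equality_algebra simY bsimY meetY (f one).
Proof.
have hM := pea_F1 hX.
split.
- split.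
  + move=> A B C; have [a <-] := f_surj A; have [b <-] := f_surj B.
    by have [c <-] := f_surj C; rewrite !f_meet (meet_assoc hM).
  + move=> A B; have [a <-] := f_surj A; have [b <-] := f_surj B.
    by rewrite !f_meet (meet_comm hM).
  + by move=> A; have [a <-] := f_surj A; rewrite f_meet (meet_idem hM).
  + by move=> A; have [a <-] := f_surj A; apply/image_le/(le_one hM).
- move=> A; have [a <-] := f_surj A.
  by have [e1 e2] := pea_F2 hX a; rewrite f_sim f_bsim e1 -e2.
- move=> A; have [a <-] := f_surj A.
  by have [e1 e2] := pea_F3 hX a; rewrite f_sim f_bsim e1 -e2.
- move=> A B C; have [a <-] := f_surj A; have [b <-] := f_surj B.
  have [c <-] := f_surj C => ab bc.
  have [a' [b' [<- <- a'b' b'c]]] := image_chain ab bc.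
  have [h1 h2 h3 h4] := pea_F4 hX a'b' b'c.
  by rewrite !f_sim !f_bsim; split; apply: image_le.
- move=> A B C; have [a <-] := f_surj A; have [b <-] := f_surj B.
  have [c <-] := f_surj C; have [h1 h2] := pea_F5 hX a b c.
  by rewrite !f_meet !f_sim !f_bsim; split; apply: image_le.
- move=> A B C; have [a <-] := f_surj A; have [b <-] := f_surj B.
  have [c <-] := f_surj C; have [h1 h2] := pea_F6 hX a b c.
  by rewrite !(f_sim, f_bsim); split; apply: image_le.
- move=> A B C; have [a <-] := f_surj A; have [b <-] := f_surj B.
  have [c <-] := f_surj C; have [h1 h2] := pea_F7 hX a b c.
  by rewrite !(f_sim, f_bsim); split; apply: image_le.
Qed.

End Image.

(** * The quotient algebra *)

Theorem theorem4p11 (X : Type) (sim bsim meet : X -> X -> X) (one : X)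
  (hX : is_pseudo_equality_algebra sim bsim meet one)
  (F : set X)
  (hF : is_deductive_system sim meet one F)
  (hFn : is_normal sim bsim F) :
  let cls := to_quotient sim F in
  let simQ := @quotient_op X sim F sim in
  let bsimQ := @quotient_op X sim F bsim in
  let meetQ := @quotient_op X sim F meet in
  (forall x y : X, simQ (cls x) (cls y) = cls (sim x y)) /\
  (forall x y : X, bsimQ (cls x) (cls y) = cls (bsim x y)) /\
  (forall x y : X, meetQ (cls x) (cls y) = cls (meet x y)) /\
  is_pseudo_equality_algebra simQ bsimQ meetQ (cls one).
Proof.
move=> cls simQ bsimQ meetQ.
have simE := quotient_op_class hX hF sim (theta_sim hX hF hFn).
have bsimE := quotient_op_class hX hF bsim (theta_bsim hX hF hFn).
have meetE := quotient_op_class hX hF meet (theta_meet hX hF).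
do 3!split=> //.
exact: (image_pseudo_equality_algebra hX (@to_quotient_surj _ sim F) simE bsimE meetE).
Qed.
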